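(* Let $v$ satisfy hypothesis (H), and let $\mu_0\in\mathcal{P}^{ac}_c$ be given. Let $\mu^k=\mu^k_{[0,T]}$ be constructed by Scheme 1 with $\Delta t=T/2^k$, starting from $\mu_0$. Then the sequence $\{\mu^k_{[0,T]}\}_{k\in\mathbb{N}}$ is a Cauchy sequence in $C([0,T],\mathcal{P}_p)$ (with respect to $d$).
   Context: Fix $p\ge 1$, $n\in\mathbb{N}$, $T>0$. $\mathcal{P}_p$ is the space of Radon probability measures on $\mathbb{R}^n$ with finite $p$-moment, endowed with the Wasserstein distance $W_p$; for absolutely continuous measures $W_p(\mu,\nu)=\inf\{(\int|\gamma(x)-x|^p d\mu)^{1/p}:\gamma\#\mu=\nu\}$, where $\gamma\#\mu(E)=\mu(\gamma^{-1}(E))$. $\mathcal{P}^{ac}_c\subset\mathcal{P}_p$ is the set of probability measures with compact support that are absolutely continuous with respect to Lebesgue measure. On $C([0,T],\mathcal{P}_p)$ set $d(\mu,\nu)=\sup_{t\in[0,T]}W_p(\mu_t,\nu_t)$. Hypothesis (H): $v:\mathcal{P}_p\to C^1(\mathbb{R}^n)\cap L^\infty(\mathbb{R}^n)$, $\mu\mapsto v[\mu]$ (vector fields on $\mathbb{R}^n$), and there are constants $L,M,K$ such that for all $\mu,\nu\in\mathcal{P}_p$, $x,y\in\mathbb{R}^n$: $|v[\mu](x)-v[\mu](y)|\le L|x-y|$, $|v[\mu](x)|\le M$, $\|v[\mu]-v[\nu]\|_{C^0}\le K\,W_p(\mu,\nu)$. Scheme 1 (Lagrangian, semi-discrete in time):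 start from $\mu_0$. Given $\mu_{i\Delta t}$, let $v_{i\Delta t}:=v[\mu_{i\Delta t}]$, with flow $\Phi^{v_{i\Delta t}}_t$, and for $t\in[i\Delta t,(i+1)\Delta t]$ set $\mu_t:=\Phi^{v_{i\Delta t}}_{t-i\Delta t}\#\mu_{i\Delta t}$. Stop at $T$. With $\Delta t=T/2^k$ the result is denoted $\mu^k$. *)

(* Defs.v *)
From HB Require Import structures.
From mathcomp Require Import all_boot all_order all_algebra.
From mathcomp Require Import all_classical all_reals all_analysis.

Set Implicit Arguments.
Unset Strict Implicit.
Unset Printing Implicit Defensive.

Import Order.TTheory GRing.Theory Num.Theory.
Import numFieldNormedType.Exports.

Local Open Scope classical_set_scope.
Local Open Scope ring_scope.

(** [Rn R n] is the space of row vectors ['rV[R]_n] with its Borel sigma-algebra.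
    Every Borel probability measure on R^n is Radon, so [prob R n] is the set
    of Radon probability measures. *)
Definition Rn (R : realType) (n : nat) :=
  g_sigma_algebraType (@open 'rV[R]_n).

Definition prob (R : realType) (n : nat) := probability (Rn R n) R.

(** The library's norm on ['rV[R]_n] is the sup norm; |x| is Euclidean here. *)
Definition enorm (R : realType) (n : nat) (x : 'rV[R]_n) : R :=
  Num.sqrt (\sum_(i < n) x 0 i ^+ 2).

(** [n]-fold product of the one-dimensional Lebesgue measure, written as an
    iterated integral; only its values on Borel sets are meaningful. *)
Fixpoint lebesgue_Rn (R : realType) (n : nat) : set 'rV[R]_n -> \bar R :=
  match n return set 'rV[R]_n -> \bar R with
  | 0 => fun A => (\1_A (0 : 'rV[R]_0))%:E
  | m.+1 => fun A : set 'rV[R]_(1 + m) =>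
      (\int[@lebesgue_measure R]_x
         @lebesgue_Rn R m [set y | A (row_mx (const_mx x) y)])%E
  end.

Definition prob_support (R : realType) (n : nat) (mu : prob R n) :
    set 'rV[R]_n :=
  [set x | forall U : set 'rV[R]_n, open U -> U x -> (0 < mu U)%E].

Definition Pp (R : realType) (n : nat) (p : R) : set (prob R n) :=
  [set mu : prob R n |
     (\int[mu]_x ((enorm (x : 'rV[R]_n) `^ p)%:E) < +oo)%E].

Definition Pacc (R : realType) (n : nat) : set (prob R n) :=
  [set mu : prob R n | compact (prob_support mu) /\
            (forall A : set (Rn R n), measurable A ->
               lebesgue_Rn A = 0%E -> mu A = 0%E)].

Definition same_prob (R : realType) (n : nat) (mu nu : prob R n) :=
  forall A : set (Rn R n), measurable A -> mu A = nu A.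

Definition transport_plan (R : realType) (n : nat) (mu nu : prob R n) :
    set (probability (Rn R n * Rn R n)%type R) :=
  [set pi : probability (Rn R n * Rn R n)%type R |
     forall A : set (Rn R n), measurable A ->
     pushforward pi fst A = mu A /\ pushforward pi snd A = nu A].

(** Kantorovich form, which makes sense on all of P_p; for absolutely
    continuous measures it agrees with the infimum over transport maps. *)
Definition Wp (R : realType) (n : nat) (p : R) (mu nu : prob R n) : \bar R :=
  ereal_inf
    [set Lnorm pi p%:E
           (fun z => (enorm ((z.1 : 'rV[R]_n) - (z.2 : 'rV[R]_n)))%:E)
    | pi in transport_plan mu nu].

Definition C1 (R : realType) (n : nat) (w : 'rV[R]_n -> 'rV[R]_n) :=
  (forall x, differentiable w x) /\ continuous (fun x => jacobian w x).

Definition C0norm (R : realType) (n : nat) (w : 'rV[R]_n -> 'rV[R]_n) :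
    \bar R :=
  ereal_sup (range (fun x => (enorm (w x))%:E)).

(** [v] is a total function on probability measures, constrained only on P_p.
    A continuous field is in L^oo exactly when it is bounded. *)
Definition hypH (R : realType) (n : nat) (p : R)
    (v : prob R n -> 'rV[R]_n -> 'rV[R]_n) :=
  (forall mu, Pp p mu -> C1 (v mu) /\ bounded_fun (v mu)) /\
  exists L M K : R,
    (forall mu, Pp p mu -> forall x y : 'rV[R]_n,
       enorm (v mu x - v mu y) <= L * enorm (x - y)) /\
    (forall mu, Pp p mu -> forall x : 'rV[R]_n, enorm (v mu x) <= M) /\
    (forall mu nu : prob R n, Pp p mu -> Pp p nu ->
       (C0norm (fun x => v mu x - v nu x)%R <= K%:E * Wp p mu nu)%E).

Definition is_flow (R : realType) (n : nat) (w : 'rV[R]_n -> 'rV[R]_n)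
    (Phi : R -> 'rV[R]_n -> 'rV[R]_n) :=
  (forall x, Phi 0 x = x) /\
  (forall (x : 'rV[R]_n) (t : R),
     is_derive t (1 : R) (fun s : R => Phi s x) (w (Phi t x))).

(** [mu] is a curve produced on [0, T] by the semi-discrete Lagrangian scheme
    with time step [dt]; its values outside [0, T] are irrelevant. *)
Definition scheme1 (R : realType) (n : nat)
    (v : prob R n -> 'rV[R]_n -> 'rV[R]_n) (mu0 : prob R n) (T dt : R)
    (mu : R -> prob R n) :=
  same_prob (mu 0) mu0 /\
  forall i : nat, i%:R * dt < T ->
    exists Phi : R -> 'rV[R]_n -> 'rV[R]_n,
      is_flow (v (mu (i%:R * dt))) Phi /\
      forall t : R, i%:R * dt <= t <= i.+1%:R * dt -> t <= T ->
        forall A : set (Rn R n), measurable A ->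
          mu t A =
          pushforward (mu (i%:R * dt)) (Phi (t - i%:R * dt) : Rn R n -> Rn R n)
            A.

Definition CPp (R : realType) (n : nat) (p T : R) : set (R -> prob R n) :=
  [set mu : R -> prob R n | (forall t, t \in `[0, T] -> Pp p (mu t)) /\
     (forall t, t \in `[0, T] ->
        Wp p (mu s) (mu t) @[s --> within `[0, T]%classic (nbhs t)]
          --> (0 : \bar R))].

Definition dCPp (R : realType) (n : nat) (p T : R) (mu nu : R -> prob R n) :
    \bar R :=
  ereal_sup [set Wp p (mu t) (nu t) | t in `[0, T]%classic].

(* Main.v *)
(** The measures of the scheme are the images of [mu0] under composed flow maps
    X^k_t, so the coupling (X^k_t, X^l_t)#mu0 gives
    W_p(mu^k_t, mu^l_t) <= sup_x |X^k_t x - X^l_t x|. For k <= l, on each cell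
    of the finer grid both maps follow fixed fields; by (H) these differ by at most
    K times (sup_x |X^k - X^l| at the start of the cell, plus M T/2^k, the
    distance travelled since the last time the coarse field was updated). A
    discrete Gronwall argument over the cells then gives
    sup_x |X^k_t x - X^l_t x| <= (exp((L + K) T) - 1) 2 M T/2^k. *)

Require Import Defs.
From HB Require Import structures.
From mathcomp Require Import all_boot all_order all_algebra.
From mathcomp Require Import all_classical all_reals all_analysis.
From mathcomp Require Import measurable_realfun.
From mathcomp Require Import ring lra.
Import Order.TTheory GRing.Theory Num.Theory.
Import numFieldNormedType.Exports.
Local Open Scope classical_set_scope.
Local Open Scope ring_scope.

Set Implicit Arguments.
Unset Strict Implicit.
Unset Printing Implicit Defensive.

(** * Euclidean norm and mean value inequality *)

Section EuclideanNorm.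
Context {R : realType} {n : nat}.
Implicit Types x y z : 'rV[R]_n.

Definition dotp x y : R := \sum_(i < n) x 0 i * y 0 i.

Lemma enorm_ge0 x : 0 <= enorm x.
Proof. exact: sqrtr_ge0. Qed.

Lemma enorm_sq x : enorm x ^+ 2 = dotp x x.
Proof.
rewrite sqr_sqrtr; first by apply: eq_bigr => i _; rewrite expr2.
by apply: sumr_ge0 => i _; exact: sqr_ge0.
Qed.

Lemma dotpC x y : dotp x y = dotp y x.
Proof. by apply: eq_bigr => i _; rewrite mulrC. Qed.

Lemma dotpDl x y z : dotp (x + y) z = dotp x z + dotp y z.
Proof. by rewrite -big_split; apply: eq_bigr => i _; rewrite mxE mulrDl. Qed.

Lemma dotpZl a x y : dotp (a *: x) y = a * dotp x y.
Proof. by rewrite mulr_sumr; apply: eq_bigr => i _; rewrite mxE mulrA. Qed.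

Lemma dotpBl x y z : dotp (x - y) z = dotp x z - dotp y z.
Proof. by rewrite dotpDl -scaleN1r dotpZl mulN1r. Qed.

Lemma enorm0 : enorm (0 : 'rV[R]_n) = 0.
Proof. by rewrite /enorm big1 ?sqrtr0// => i _; rewrite mxE expr0n. Qed.

Lemma enormN x : enorm (- x) = enorm x.
Proof. by congr Num.sqrt; apply: eq_bigr => i _; rewrite mxE sqrrN. Qed.

Lemma enormBC x y : enorm (x - y) = enorm (y - x).
Proof. by rewrite -enormN opprB. Qed.

Lemma ler_coord_enorm x i : `|x 0 i| <= enorm x.
Proof.
rewrite -sqrtr_sqr ler_wsqrtr// (bigD1 i)//= lerDl.
by apply: sumr_ge0 => j _; exact: sqr_ge0.
Qed.

Lemma ler_norm_enorm x : `|x| <= enorm x.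
Proof.
rewrite [leLHS]/Num.Def.normr/= mx_normrE; apply: bigmax_le => [|[i j] _].
  exact: enorm_ge0.
by rewrite ord1; exact: ler_coord_enorm.
Qed.

Lemma enorm_eq0 x : enorm x = 0 -> x = 0.
Proof.
move=> x0; apply/normr0_eq0/eqP; rewrite eq_le normr_ge0 andbT.
by rewrite -x0 ler_norm_enorm.
Qed.

Lemma dotp_le x y : dotp x y <= enorm x * enorm y.
Proof.
have [/eqP y0|y0] := boolP (enorm y == 0).
  rewrite (enorm_eq0 y0) enorm0 mulr0 dotpC /dotp big1// => i _.
  by rewrite mxE mul0r.
have {}y0 : 0 < enorm y by rewrite lt_def y0 enorm_ge0.
(* Cauchy-Schwarz without division: the square of this norm equals
   [|y|^2 (|x|^2 |y|^2 - <x,y>^2)]. *)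
have := sqr_ge0 (enorm (enorm y ^+ 2 *: x - dotp x y *: y)).
rewrite [X in 0 <= X]enorm_sq dotpBl !dotpZl !(dotpC _ (_ - _)) !dotpBl !dotpZl.
rewrite -!enorm_sq.
rewrite (dotpC y x) => h.
have {}h : 0 <= enorm y ^+ 2 * ((enorm x * enorm y) ^+ 2 - dotp x y ^+ 2).
  by apply: le_trans h _; rewrite le_eqVlt; apply/orP; left; apply/eqP; ring.
rewrite pmulr_rge0 ?exprn_gt0// subr_ge0 in h.
apply: le_trans (ler_norm _) _.
rewrite -(ler_pXn2r (ltn0Sn 1)) ?nnegrE ?mulr_ge0 ?enorm_ge0//.
by rewrite real_normK ?num_real.
Qed.

Lemma ler_enormD x y : enorm (x + y) <= enorm x + enorm y.
Proof.
rewrite -(ler_pXn2r (ltn0Sn 1)) ?nnegrE ?addr_ge0 ?enorm_ge0// enorm_sq.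
rewrite dotpDl !(dotpC _ (_ + _)) !dotpDl -!enorm_sq (dotpC y x) sqrrD.
have := dotp_le x y; lra.
Qed.

Lemma ler_enormB_trans z x y : enorm (x - y) <= enorm (x - z) + enorm (z - y).
Proof. by rewrite -{1}(subrK z x) -addrA; exact: ler_enormD. Qed.

Lemma enorm_continuous : continuous (@enorm R n).
Proof.
move=> x; apply: continuous_comp; last exact: sqrt_continuous.
have -> : (fun z : 'rV[R]_n => \sum_(i < n) z 0 i ^+ 2) =
    \sum_(i < n) (fun z : 'rV[R]_n => z 0 i ^+ 2).
  by apply/funext => z; rewrite fct_sumE.
elim/big_ind: _ => [|f g cf cg|i _]; first exact: cst_continuous.
  exact: continuousD.
by apply: continuousM; exact: coord_continuous.
Qed.

End EuclideanNorm.

Section MeanValue.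
Context {R : realType} {n : nat}.

Lemma is_derive_coord (f : R -> 'rV[R]_n) (df : 'rV[R]_n) (t : R) i :
  is_derive t (1 : R) f df -> is_derive t (1 : R) (fun s => f s 0 i) (df 0 i).
Proof.
move=> [fd fv]; have /derivable_mxP fi := fd.
by split; [exact: fi|rewrite -fv derive_mx// mxE].
Qed.

Lemma is_derive_dotp (f : R -> 'rV[R]_n) (df e : 'rV[R]_n) (t : R) :
  is_derive t (1 : R) f df ->
  is_derive t (1 : R) (fun s => dotp (f s) e) (dotp df e).
Proof.
move=> fd.
have -> : (fun s => dotp (f s) e) =
    \sum_(i < n) (fun s => e 0 i * f s 0 i).
  by apply/funext => s; rewrite fct_sumE; apply: eq_bigr => i _; rewrite mulrC.
rewrite dotpC; apply: is_derive_sum => i.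
by apply: is_deriveZ; exact: is_derive_coord.
Qed.

(* Tests the increment against itself to reduce to the scalar mean value
   theorem. *)
Lemma enorm_MVT (f df : R -> 'rV[R]_n) (s t B : R) : s <= t ->
  (forall r, is_derive r (1 : R) f (df r)) ->
  (forall r, s <= r <= t -> enorm (df r) <= B) ->
  enorm (f t - f s) <= B * (t - s).
Proof.
rewrite le_eqVlt => /predU1P[->|st] fd dfB; first by rewrite !subrr enorm0 mulr0.
set e := f t - f s.
have [/eqP e0|e0] := boolP (enorm e == 0).
  rewrite e0 mulr_ge0//; last by rewrite subr_ge0 ltW.
  by apply: le_trans (dfB s _); rewrite ?enorm_ge0// lexx ltW.
have [|c cst] := MVT st (fun r _ => is_derive_dotp e (fd r)).
  apply: continuous_subspaceT => r.
  apply/differentiable_continuous/derivable1_diffP.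
  exact: (@ex_derive _ _ _ _ _ _ _ (is_derive_dotp e (fd r))).
rewrite -dotpBl -/e -enorm_sq => h.
have {}e0 : 0 < enorm e by rewrite lt_def e0 enorm_ge0.
(* The scalar theorem gave [|e|^2 = <df c, e> (t - s)]; Cauchy-Schwarz bounds the right side, and
   one factor [|e|] cancels. *)
rewrite -(ler_pM2l e0) -expr2 h mulrA ler_wpM2r//; first by rewrite subr_ge0 ltW.
rewrite (le_trans (dotp_le _ _))// mulrC ler_wpM2l ?enorm_ge0// dfB//.
by move: cst; rewrite in_itv/= => /andP[/ltW -> /ltW ->].
Qed.

End MeanValue.

(** * Borel measures on R^n and couplings *)

Section BorelRn.
Context {R : realType} {n : nat}.

Lemma open_measurable_Rn (A : set 'rV[R]_n) :
  open A -> measurable (A : set (Rn R n)).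
Proof. by move=> oA; exact: sub_sigma_algebra. Qed.

Lemma continuous_measurable_Rn (f : 'rV[R]_n -> 'rV[R]_n) :
  continuous f -> measurable_fun [set: Rn R n] (f : Rn R n -> Rn R n).
Proof.
move=> /continuousP cf.
apply: (@measurability _ _ (Rn R n) (Rn R n) _ _ (@open 'rV[R]_n)).
  by rewrite /measurable/=.
by move=> _ [A oA <-]; rewrite setTI; apply: open_measurable_Rn; exact: cf.
Qed.

Lemma continuous_measurable_RnR (f : 'rV[R]_n -> R) :
  continuous f -> measurable_fun [set: Rn R n] (f : Rn R n -> R).
Proof.
move=> /continuousP cf; apply: (measurability _ (RGenOpens.measurableE R)).
move=> _ [_ [a [b ->] <-]]; rewrite setTI.
apply: open_measurable_Rn; exact/cf/interval_open.
Qed.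

(** The sigma-algebra is the product of two Borel ones, so measurability is checked coordinate by
    coordinate rather than read off from continuity on the product space. *)
Lemma measurable_enormB :
  measurable_fun [set: Rn R n * Rn R n]
    (fun z => enorm ((z.1 : 'rV[R]_n) - (z.2 : 'rV[R]_n))).
Proof.
rewrite /enorm; apply: (measurableT_comp (f := @Num.sqrt R)).
  by apply: continuous_measurable_fun; exact: sqrt_continuous.
apply: measurable_sum => i; apply: measurable_funX.
rewrite [X in measurable_fun _ X](_ : _ =
    (fun z : Rn R n * Rn R n => (z.1 : 'rV[R]_n) 0 i - (z.2 : 'rV[R]_n) 0 i)).
  apply: measurable_funB.
    apply: (measurableT_comp (f := fun x : Rn R n => (x : 'rV[R]_n) 0 i)) => //.
    by apply: continuous_measurable_RnR; exact: coord_continuous.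
  apply: (measurableT_comp (f := fun x : Rn R n => (x : 'rV[R]_n) 0 i)) => //.
  by apply: continuous_measurable_RnR; exact: coord_continuous.
by apply/funext => z; rewrite !mxE.
Qed.

(** Finitely many of the null open sets already cover [K]. *)
Lemma compact_negligible (mu : prob R n) (K : set 'rV[R]_n) : compact K ->
  (forall x, K x -> exists2 U : set 'rV[R]_n, open U /\ U x & mu U = 0%E) ->
  mu.-negligible (K : set (Rn R n)).
Proof.
rewrite compact_cover => Kco Knull.
(* The guard [K x] makes the relation total, as [choice] requires; off [K] any set will do. *)
pose P x U := K x -> [/\ open U, U x & mu (U : set (Rn R n)) = 0%E].
have [f Pf] : {f : 'rV[R]_n -> set 'rV[R]_n & forall x, P x (f x)}.
  apply: (@choice _ _ P) => x; rewrite /P.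
  have [/Knull[U [oU Ux] U0]|nKx] := pselect (K x); first by exists U.
  by exists setT.
have [x Kx|x Kx|D DK] := Kco _ K f; first by case: (Pf x Kx).
  by exists x => //; case: (Pf x Kx).
move=> KD; apply: (negligibleS (KD : (K : set (Rn R n)) `<=` _)).
rewrite /cover bigcup_fset big_seq.
elim/big_ind : _ => [|A B|x /DK]; first exact: negligible_set0.
  exact: negligibleU.
rewrite inE => /Pf[ox _ x0].
by apply/negligibleP => //; exact: open_measurable_Rn.
Qed.

(** Concentration on a ball stands in for compact support: it passes through maps of bounded
    displacement and yields finite moments. *)
Definition enorm_bounded (r : R) (mu : prob R n) :=
  mu.-negligible [set x : Rn R n | r <= enorm (x : 'rV[R]_n)].

Lemma closed_enorm_ge (r : R) : closed [set x : 'rV[R]_n | r <= enorm x].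
Proof.
have /continuous_closedP cf := @enorm_continuous R n.
rewrite (_ : [set _ | _] = @enorm R n @^-1` [set y | r <= y]) //.
apply: cf; exact: closed_ge.
Qed.

(* Exhausting the complement of a large ball by compact annuli off the support
   avoids the Lindelof property of R^n. *)
Lemma Pacc_enorm_bounded (mu : prob R n) :
  Pacc mu -> exists r, enorm_bounded r mu.
Proof.
move=> [Sco _].
have : compact (@enorm R n @` prob_support mu).
  by apply: continuous_compact => //; exact/continuous_subspaceT/enorm_continuous.
move=> /compact_bounded[M [_ HM]].
(* [HM] bounds the norm on the support only by numbers strictly above [M]; it is used at [M + 1],
   and radius [M + 2] lies strictly beyond that. *)
exists (M + 2); rewrite /enorm_bounded.
pose K (N : nat) : set 'rV[R]_n :=
  [set x | M + 2 <= enorm x] `&` [set x | `|x| <= N%:R].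
apply: (@negligibleS _ _ _ _ (\bigcup_N (K N : set (Rn R n)))).
  move=> x Mx.
  exists (Num.truncn `|x : 'rV[R]_n|).+1 => //; split=> //=.
  exact/ltW/truncnS_gt.
apply: negligible_bigcup => N; apply: compact_negligible.
  apply: bounded_closed_compact.
    exists N%:R; split=> // y yN x [_ /= xN].
    exact: le_trans xN (ltW yN).
  apply: closedI; first exact: closed_enorm_ge.
  rewrite (_ : [set x | _] = (fun x : 'rV[R]_n => `|x|) @^-1` [set y | y <= N%:R])//.
  by apply: (continuous_closedP _).1; [exact: norm_continuous|exact: closed_le].
move=> x [/= Mx _].
have : ~ prob_support mu x.
  move=> Sx; have /HM/(_ (enorm x)) : M < M + 1 by rewrite ltrDl.
  have Ax : (@enorm R n @` prob_support mu) (enorm x) by exists x.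
  by move=> /(_ Ax); rewrite /= ger0_norm ?enorm_ge0//; move: Mx; lra.
move=> /existsNP[U] /not_implyP[oU] /not_implyP[Ux] /negP.
rewrite -leNgt measure_le0 => /eqP.
by exists U.
Qed.

Lemma enorm_bounded_Pp (p r : R) (mu : prob R n) : 0 <= p ->
  enorm_bounded r mu -> Pp p mu.
Proof.
move=> p0 mur; rewrite /Pp/=.
apply: (@le_lt_trans _ _ (\int[mu]_x (cst (`|r| `^ p)%:E x))%E).
  apply: ae_ge0_le_integral => //.
  - by move=> x _; rewrite lee_fin powR_ge0.
  - apply/measurable_EFinP; apply: (measurableT_comp (measurable_powR p)).
    by apply: continuous_measurable_RnR; exact: enorm_continuous.
  - by move=> x _; rewrite lee_fin powR_ge0.
  apply: negligibleS mur => x /= /not_implyP[_ /negP].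
  rewrite lee_fin; apply: contraNle => xr.
  rewrite ge0_ler_powR ?nnegrE ?enorm_ge0//.
  exact: le_trans (ltW xr) (ler_norm _).
by rewrite integral_cst// [X in (_ * X)%E]probability_setT mule1 ltry.
Qed.

(** By the triangle inequality, a point sent outside radius [r + c] was already outside radius
    [r]. *)
Lemma enorm_bounded_pushforward (r c : R) (mu nu : prob R n)
    (f : 'rV[R]_n -> 'rV[R]_n) :
  measurable_fun [set: Rn R n] (f : Rn R n -> Rn R n) ->
  (forall A : set (Rn R n), measurable A -> nu A = mu (f @^-1` A)) ->
  (forall x, enorm (f x - x) <= c) ->
  enorm_bounded r mu -> enorm_bounded (r + c) nu.
Proof.
move=> mf nuE fc mur; rewrite /enorm_bounded.
have mA : measurable [set x : Rn R n | r + c <= enorm (x : 'rV[R]_n)].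
  rewrite -[X in measurable X]setCK; apply: measurableC.
  by apply: open_measurable_Rn; rewrite openC; exact: closed_enorm_ge.
apply/negligibleP => //; apply: etrans (nuE _ mA) _; apply: measure_negligible.
  by rewrite -[X in measurable X]setTI; exact: mf.
apply: negligibleS mur => x /= h.
have := ler_enormD (f x - x) x; rewrite subrK.
move: h (fc x); lra.
Qed.

Lemma Wp_ge0 (p : R) (mu nu : prob R n) : (0 <= Wp p mu nu)%E.
Proof. by apply: le_ereal_inf_tmp => _ [pi _ <-]; exact: Lnorm_ge0. Qed.

(** The image of [m] under [x |-> (f x, g x)] is a transport plan whose cost is integrated against
    [m], where it is bounded pointwise. *)
Lemma Wp_le_sup (p c : R) (m mu nu : prob R n) (f g : 'rV[R]_n -> 'rV[R]_n) :
  1 <= p ->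
  measurable_fun [set: Rn R n] (f : Rn R n -> Rn R n) ->
  measurable_fun [set: Rn R n] (g : Rn R n -> Rn R n) ->
  (forall A : set (Rn R n), measurable A -> mu A = m (f @^-1` A)) ->
  (forall A : set (Rn R n), measurable A -> nu A = m (g @^-1` A)) ->
  (forall x, enorm (f x - g x) <= c) -> (Wp p mu nu <= c%:E)%E.
Proof.
move=> p1 mf mg muE nuE fgc.
have c0 : 0 <= c by apply: le_trans (fgc 0); exact: enorm_ge0.
have p0 : 0 < p by apply: lt_le_trans p1.
pose h (x : Rn R n) : Rn R n * Rn R n := (f x, g x).
have mh : measurable_fun setT h by exact: measurable_fun_pair.
pose hm : {mfun Rn R n >-> (Rn R n * Rn R n)%type} :=
  HB.pack h (isMeasurableFun.Build _ _ _ _ h mh).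
pose pi : probability _ _ := distribution m hm.
apply: (@le_trans _ _ (Lnorm pi p%:E
    (fun z => (enorm ((z.1 : 'rV[R]_n) - (z.2 : 'rV[R]_n)))%:E))).
  apply: ereal_inf_lbound; exists pi => // A mA; split.
    by rewrite muE.
  by rewrite nuE.
rewrite unlock /Lnorm.
(* Written as a [p]-th root, the bound can be compared with the [L^p] norm under the root. *)
have -> : c%:E = ((c `^ p)%:E `^ p^-1)%E.
  by rewrite poweR_EFin -powRrM divff ?gt_eqF// powRr1.
apply: gt0_ler_poweR.
- by rewrite invr_ge0 ltW.
- by rewrite in_itv/= leey andbT; apply: integral_ge0.
- by rewrite in_itv/= leey andbT lee_fin powR_ge0.
under eq_integral do rewrite abse_EFin poweR_EFin ger0_norm ?enorm_ge0//.
have mphi : measurable_fun setT (fun z : Rn R n * Rn R n =>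
    ((enorm ((z.1 : 'rV[R]_n) - (z.2 : 'rV[R]_n))) `^ p)%:E).
  apply/measurable_EFinP; apply: (measurableT_comp (measurable_powR p)).
  exact: measurable_enormB.
rewrite ge0_integral_pushforward//; last by move=> z _; rewrite lee_fin powR_ge0.
apply: (@le_trans _ _ (\int[m]_x (cst (c `^ p)%:E x))%E).
  rewrite preimage_setT; apply: ge0_le_integral => //.
  - by move=> x _; rewrite lee_fin powR_ge0.
  - exact: (measurableT_comp mphi mh).
  - move=> x _; rewrite lee_fin/= ge0_ler_powR ?nnegrE ?enorm_ge0//.
    exact: ltW.
by rewrite integral_cst// [X in (_ * X)%E]probability_setT mule1.
Qed.

End BorelRn.

(** * Lipschitz flows *)

(** The recursion says that [u + b] grows by a factor of at most [1 + a] per step, and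
    [1 + a <= expR a]. *)
Lemma discrete_gronwall (R : realType) (u : nat -> R) (a b : R) (N : nat) :
  0 <= a -> 0 <= b -> 0 <= u 0 ->
  (forall j, (j < N)%N -> u j.+1 <= (1 + a) * u j + a * b) ->
  u N + b <= expR (a * N%:R) * (u 0 + b).
Proof.
move=> a0 b0 u0 hu.
apply: (@le_trans _ _ ((1 + a) ^+ N * (u 0 + b))).
  elim: N hu => [|N IH] hu; first by rewrite expr0 mul1r.
  apply: (@le_trans _ _ ((1 + a) * (u N + b))); first by have := hu N (ltnSn N); lra.
  rewrite exprS -mulrA ler_wpM2l ?addr_ge0// IH// => j jN.
  by rewrite hu// ltnS ltnW.
rewrite ler_wpM2r ?addr_ge0// mulrC expRM_natl.
by rewrite lerXn2r ?nnegrE ?addr_ge0 ?expR_ge0// expR_ge1Dx.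
Qed.

Section Fields.
Context {R : realType} {n : nat}.

Definition elipschitz (L : R) (w : 'rV[R]_n -> 'rV[R]_n) :=
  forall x y, enorm (w x - w y) <= L * enorm (x - y).

Definition ebounded (M : R) (w : 'rV[R]_n -> 'rV[R]_n) :=
  forall x, enorm (w x) <= M.

Definition solves (w : 'rV[R]_n -> 'rV[R]_n) (y : R -> 'rV[R]_n) :=
  forall t : R, is_derive t (1 : R) y (w (y t)).

Lemma solves_speed (M : R) w y s t : ebounded M w -> solves w y -> s <= t ->
  enorm (y t - y s) <= M * (t - s).
Proof. by move=> wM yw st; apply: enorm_MVT st yw _ => r _; exact: wM. Qed.

(** On [[s, t]] the gap is at most its initial value plus [2 M (t - s)], since both speeds are at
    most [M]. This crude bound controls the difference of the velocities, and the mean value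
    inequality leaves an error quadratic in [t - s]. *)
Lemma solves_step (L M e : R) w w' y z s t :
  0 <= L -> elipschitz L w -> ebounded M w -> ebounded M w' ->
  (forall x, enorm (w x - w' x) <= e) ->
  solves w y -> solves w' z -> s <= t ->
  enorm (y t - z t) <=
    (1 + L * (t - s)) * enorm (y s - z s) + (t - s) * (e + L * (2 * M * (t - s))).
Proof.
move=> L0 wL wM w'M ww' yw zw st.
have M0 : 0 <= M by apply: le_trans (wM 0); exact: enorm_ge0.
set u := enorm (y s - z s).
have inc : enorm ((y t - z t) - (y s - z s)) <=
    (e + L * (u + 2 * M * (t - s))) * (t - s).
  apply: (@enorm_MVT _ _ (fun r => y r - z r) (fun r => w (y r) - w' (z r))) => //.
    by move=> r; apply: is_deriveB.
  move=> r /andP[sr rt].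
  have yr := solves_speed wM yw sr; have zr := solves_speed w'M zw sr.
  have Mr : M * (r - s) <= M * (t - s) by rewrite ler_wpM2l// lerB.
  have yzr : enorm (y r - z r) <= u + 2 * M * (t - s).
    have := ler_enormB_trans (y s) (y r) (z r).
    have := ler_enormB_trans (z s) (y s) (z r).
    rewrite (enormBC (z s)) -/u; lra.
  have := ler_enormB_trans (w (z r)) (w (y r)) (w' (z r)).
  have := ww' (z r).
  have := le_trans (wL (y r) (z r)) (ler_wpM2l L0 yzr); lra.
have := ler_enormD ((y t - z t) - (y s - z s)) (y s - z s).
rewrite subrK -/u; lra.
Qed.

(** Serves to make the flow maps continuous, hence Borel, which [is_flow] does not assert. *)
Lemma flow_lipschitz (L M : R) w Phi t :
  0 <= L -> elipschitz L w -> ebounded M w -> is_flow w Phi -> 0 <= t ->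
  elipschitz (expR (L * t)) (Phi t).
Proof.
move=> L0 wL wM [Phi0 dPhi] t0 x y.
have M0 : 0 <= M by apply: le_trans (wM 0); exact: enorm_ge0.
(* Over N equal steps the errors of [solves_step] accumulate to O(1/N). *)
apply/ler_addgt0Pr => e e0.
(* Chosen so that the accumulated error [expR (L * t) * (2 * M * (t / N))] is at most [e]. *)
pose N := (Num.truncn (expR (L * t) * 2 * M * t / e)).+1.
have N0 : 0 < N%:R :> R by rewrite ltr0n.
pose h := t / N%:R; have h0 : 0 <= h by rewrite divr_ge0// ltW.
pose u (j : nat) := enorm (Phi (j%:R * h) x - Phi (j%:R * h) y).
have NhE : N%:R * h = t by rewrite mulrC divfK// gt_eqF.
have hu j : (j < N)%N -> u j.+1 <= (1 + L * h) * u j + L * h * (2 * M * h).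
  move=> _; have jh : j%:R * h <= j.+1%:R * h by rewrite ler_wpM2r// ler_nat.
  have := @solves_step L M 0 w w (Phi ^~ x) (Phi ^~ y) _ _ L0 wL wM wM _
    (dPhi x) (dPhi y) jh.
  rewrite /u -mulrBl -natrB// subSnn mul1r add0r => h1.
  rewrite [leRHS](_ : _ =
    (1 + L * h) * enorm (Phi (j%:R * h) x - Phi (j%:R * h) y) +
    h * (L * (2 * M * h))); last by ring.
  by apply: h1 => z; rewrite subrr enorm0.
have := discrete_gronwall _ _ _ hu.
rewrite !mulr_ge0// enorm_ge0 => /(_ isT isT isT).
rewrite (_ : L * h * N%:R = L * t); last by rewrite -NhE; ring.
rewrite /u NhE mul0r !Phi0 mulrDr => hN.
have Ee : expR (L * t) * (2 * M * h) <= e.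
  rewrite /h !mulrA ler_pdivrMr// (mulrC e) -ler_pdivrMr//.
  exact/ltW/truncnS_gt.
have Mh : 0 <= 2 * M * h by rewrite !mulr_ge0.
lra.
Qed.

(** The topology is that of the sup norm: [enorm] dominates this norm and is itself continuous, so
    the two can be exchanged. *)
Lemma elipschitz_continuous (L : R) (f : 'rV[R]_n -> 'rV[R]_n) :
  elipschitz L f -> continuous f.
Proof.
move=> fL x; apply: (cvgrPdist_lt (FF := nbhs_filter x) _ _).2 => e e0.
have cB : continuous (fun y : 'rV[R]_n => x - y).
  by move=> y; apply: continuousB; [exact: cst_continuous|exact: cvg_id].
have cx y : {for y, continuous (fun y : 'rV[R]_n => L * enorm (x - y))}.
  apply: (@continuousM R _ (cst L) (fun y : 'rV[R]_n => enorm (x - y)) y).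
    exact: cst_continuous.
  exact: (continuous_comp (cB y) (@enorm_continuous R n _)).
have L0 : L * enorm (x - x) < e by rewrite subrr enorm0 mulr0.
near=> y; apply: le_lt_trans (ler_norm_enorm _) _.
apply: le_lt_trans (fL x y) _.
by near: y; exact: (cvgr_lt _ (cx x)).
Unshelve. all: by end_near. Qed.

End Fields.

(** * Flow maps of the scheme *)

Section Trajectories.
Context {R : realType} {n : nat}.
Implicit Types (v : prob R n -> 'rV[R]_n -> 'rV[R]_n).

(** The dependence on the measure is phrased through a real bound [c] on the distance, so later
    estimates stay in [R]. *)
Definition field_bounds (p : R) v (L M K : R) :=
  [/\ 0 <= L, 0 <= M, 0 <= K,
      forall mu, Pp p mu -> elipschitz L (v mu) /\ ebounded M (v mu) &
      forall mu nu c, Pp p mu -> Pp p nu -> (Wp p mu nu <= c%:E)%E ->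
        forall x, enorm (v mu x - v nu x) <= K * c].

(** Each constant is replaced by its maximum with 0, which keeps the bounds because norms and
    distances are nonnegative. *)
Lemma hypH_field_bounds (p : R) v :
  hypH p v -> exists L M K, field_bounds p v L M K.
Proof.
move=> [_ [L [M [K [vL [vM vK]]]]]].
exists (Num.max L 0), (Num.max M 0), (Num.max K 0).
split; rewrite ?le_max ?lexx ?orbT//.
  move=> mu mup; split=> [x y|x].
    by apply: le_trans (vL _ mup x y) _; rewrite ler_wpM2r ?enorm_ge0// le_max lexx.
  by apply: le_trans (vM _ mup x) _; rewrite le_max lexx.
move=> mu nu c mup nup Wc x; rewrite -lee_fin.
apply: (@le_trans _ _ (C0norm (fun x => v mu x - v nu x))).
  by apply: ereal_sup_ubound; exists x.
apply: le_trans (vK _ _ mup nup) _.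
apply: (@le_trans _ _ ((Num.max K 0)%:E * Wp p mu nu)%E).
  by apply: lee_wpmul2r; [exact: Wp_ge0|rewrite lee_fin le_max lexx].
by rewrite EFinM lee_wpmul2l// lee_fin le_max lexx orbT.
Qed.

Lemma is_derive_shiftr (f : R -> 'rV[R]_n) (df : 'rV[R]_n) (a t : R) :
  is_derive (t - a) (1 : R) f df ->
  is_derive t (1 : R) (fun s => f (s - a)) df.
Proof.
have E : (fun h : R => h^-1 *: (((fun s => f (s - a)) \o shift t) (h *: (1 : R)) -
      (fun s => f (s - a)) t)) =
    (fun h : R => h^-1 *: ((f \o shift (t - a)) (h *: (1 : R)) - f (t - a))).
  by apply/funext => h /=; rewrite addrA.
by move=> [fd fv]; split; rewrite /derivable/derive E.
Qed.

Lemma time_cell (T dt t : R) : 0 < T -> 0 < dt -> 0 <= t <= T ->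
  exists2 i : nat, i%:R * dt < T & i%:R * dt <= t <= i.+1%:R * dt.
Proof.
move=> T0 dt0 /andP[t0 tT].
have q0 : 0 <= t / dt by rewrite divr_ge0// ltW.
have /andP[h1 h2] := truncn_itv q0.
rewrite ler_pdivlMr// in h1; rewrite ltr_pdivrMr// in h2.
(* If the cell found starts at [T], then [t = T] is the right end of the preceding cell, which does
   start before [T]; index 0 is excluded by [0 < T]. *)
have := le_trans h1 tT; rewrite le_eqVlt => /predU1P[E|h]; last first.
  by exists (Num.truncn (t / dt)) => //; rewrite h1 ltW.
case: (Num.truncn (t / dt)) E h1 h2 => [|i] E h1 h2.
  by move: T0; rewrite -E mul0r ltxx.
exists i; first by rewrite -E ltr_pM2r// ltr_nat.
by rewrite E tT andbT (le_trans _ h1)// ler_wpM2r ?(ltW dt0)// ler_nat.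
Qed.

Definition transports (m mu : prob R n) (f : 'rV[R]_n -> 'rV[R]_n) :=
  measurable_fun [set: Rn R n] (f : Rn R n -> Rn R n) /\
  forall A : set (Rn R n), measurable A -> mu A = m (f @^-1` A).

Lemma transports_comp (m mu nu : prob R n) f g :
  transports m mu f -> transports mu nu g -> transports m nu (g \o f).
Proof.
move=> [mf muE] [mg nuE]; split; first exact: measurableT_comp mg mf.
move=> A mA; rewrite nuE// muE//.
by rewrite -[X in measurable X]setTI; exact: mg.
Qed.

(** The scheme in terms of characteristics issued at time 0: runs with different steps share the
    measure [m] and can be coupled through it. The solution [y] changes from cell to cell, so [X]
    need not be differentiable at grid times. *)
Definition lagrangian v (m : prob R n) (T dt : R) (mu : R -> prob R n)
    (X : R -> 'rV[R]_n -> 'rV[R]_n) :=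
  [/\ forall x, X 0 x = x,
      forall t : R, 0 <= t <= T -> transports m (mu t) (X t) &
      forall (i : nat) x, i%:R * dt < T ->
        exists2 y, solves (v (mu (i%:R * dt))) y &
          forall t, i%:R * dt <= t <= i.+1%:R * dt -> t <= T -> X t x = y t].

(** Both conclusions are proved together, cell by cell: the bounds on the field hold only once the
    measure is known to lie in [Pp], and they in turn control the next flow map. *)
Lemma scheme1_lagrangian (p r : R) v (L M K T dt : R) (m : prob R n)
    (mu : R -> prob R n) :
  0 <= p -> 0 < T -> 0 < dt -> field_bounds p v L M K -> enorm_bounded r m ->
  scheme1 v m T dt mu ->
  (forall t : R, 0 <= t <= T -> Pp p (mu t)) /\
  exists X, lagrangian v m T dt mu X.
Proof.
move=> p0 T0 dt0 [L0 M0 K0 vLM vK] mr [mu0 hmu].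
pose P (i : nat) (Phi : R -> 'rV[R]_n -> 'rV[R]_n) :=
  (forall x, Phi 0 x = x) /\
  (i%:R * dt < T -> is_flow (v (mu (i%:R * dt))) Phi /\
    forall t, i%:R * dt <= t <= i.+1%:R * dt -> t <= T ->
      forall A : set (Rn R n), measurable A ->
        mu t A = mu (i%:R * dt) (Phi (t - i%:R * dt) @^-1` A)).
have [Phi PPhi] : {Phi : nat -> R -> 'rV[R]_n -> 'rV[R]_n & forall i, P i (Phi i)}.
  apply: (@choice _ _ P) => i.
  have [/hmu[F [Ffl FE]]|h] := pselect (i%:R * dt < T).
    by exists F; split=> [|_]; [case: Ffl|].
  by exists (fun _ x => x); split.
(* The values of [Phi i] with [T <= i dt] are irrelevant; only [Phi i 0 = id]
   is needed, at [t = T]. *)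
pose Y i := iteri i (fun j f => Phi j dt \o f) id.
pose X t := let i := Num.truncn (t / dt) in Phi i (t - i%:R * dt) \o Y i.
(* Valid at both ends of the cell: at the right end [truncn] returns [i.+1], but [Phi i.+1 0] is the
   identity and [Y i.+1] ends with [Phi i dt]. *)
have XE (i : nat) t : i%:R * dt <= t <= i.+1%:R * dt ->
    X t = Phi i (t - i%:R * dt) \o Y i.
  move=> /andP[h1]; rewrite le_eqVlt => /predU1P[->|h2]; last first.
    rewrite /X /= (_ : Num.truncn _ = i)//.
    by apply: truncn_def; rewrite ler_pdivlMr// h1 ltr_pdivrMr.
  rewrite /X/= mulfK ?gt_eqF// natrK subrr -mulrBl -natrB// subSnn mul1r.
  by apply/funext => x /=; rewrite (PPhi i.+1).1.
have X0 : X 0 = id.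
  rewrite (XE 0%N); last by rewrite mul0r lexx mul1r ltW.
  by apply/funext => x /=; rewrite mul0r subr0 (PPhi 0%N).1.
have XY i : X (i%:R * dt) = Y i.
  rewrite (XE i); last by rewrite lexx ler_wpM2r ?(ltW dt0)// ler_nat.
  by apply/funext => x /=; rewrite subrr (PPhi i).1.
(* The displacement bound keeps [mu t] concentrated on the ball of radius [r + M * t], hence in
   [Pp]. *)
pose good t := transports m (mu t) (X t) /\ forall x, enorm (X t x - x) <= M * t.
have goodPp t : good t -> Pp p (mu t).
  move=> [[mX muE] XM]; apply: enorm_bounded_Pp p0 _.
  exact: enorm_bounded_pushforward mX muE XM mr.
have step i : i%:R * dt < T -> good (i%:R * dt) ->
    forall t, i%:R * dt <= t <= i.+1%:R * dt -> t <= T -> good t.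
  move=> iT gi t it tT; have [vL vM] := vLM _ (goodPp _ gi).
  have [_ /(_ iT)[fl muE]] := PPhi i; have ti : 0 <= t - i%:R * dt.
    by rewrite subr_ge0; case/andP: it.
  have mPhi := continuous_measurable_Rn (elipschitz_continuous
    (flow_lipschitz L0 vL vM fl ti)).
  rewrite /good (XE _ _ it) -XY; split.
    apply: transports_comp gi.1 _; split=> // A mA.
    exact: muE.
  move=> x /=; set z := X _ x.
  have := ler_enormB_trans z (Phi i (t - i%:R * dt) z) x.
  have := gi.2 x; rewrite -/z.
  have := @solves_speed _ _ M _ (Phi i ^~ z) 0 (t - i%:R * dt) vM (fl.2 z) ti.
  rewrite subr0 /= (PPhi i).1 => h1 h2 h3.
  have -> : M * t = M * (t - i%:R * dt) + M * (i%:R * dt) by ring.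
  lra.
have goodi i : i%:R * dt <= T -> good (i%:R * dt).
  elim: i => [_|i IH iT].
    rewrite mul0r /good X0 mulr0; split=> [|x]; last by rewrite subrr enorm0.
    by split=> [|A mA]; [exact: measurable_id|exact: mu0].
  have lt_i : i%:R * dt < i.+1%:R * dt by rewrite ltr_pM2r// ltr_nat.
  have iT' := lt_le_trans lt_i iT.
  by apply: (step i iT' (IH (ltW iT'))) => //; rewrite (ltW lt_i) lexx.
have goodt t : 0 <= t <= T -> good t.
  move=> tT; have [i iT it] := time_cell T0 dt0 tT.
  by apply: (step i iT (goodi i (ltW iT))) => //; case/andP: tT.
split=> [t /goodt/goodPp//|]; exists X; split=> [x|t /goodt[]//|i x iT].
  by rewrite X0.
have [_ /(_ iT)[[_ dPhi] _]] := PPhi i.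
exists (fun t => Phi i (t - i%:R * dt) (Y i x)) => [t|t it _]; last first.
  by rewrite (XE _ _ it).
by apply: is_derive_shiftr; exact: dPhi.
Qed.

Lemma lagrangian_speed (p : R) v (L M K T dt : R) (m : prob R n)
    (mu : R -> prob R n) X x (s t : R) :
  0 < T -> 0 < dt -> field_bounds p v L M K ->
  (forall t : R, 0 <= t <= T -> Pp p (mu t)) -> lagrangian v m T dt mu X ->
  0 <= s -> s <= t -> t <= T -> enorm (X t x - X s x) <= M * (t - s).
Proof.
move=> T0 dt0 [L0 M0 K0 vLM vK] muP [_ _ Xode] s0.
suff H (i : nat) : forall t, s <= t -> t <= T -> t <= i%:R * dt ->
    enorm (X t x - X s x) <= M * (t - s).
  move=> st tT; have [|i _ /andP[_ ti]] := @time_cell T dt t T0 dt0.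
    by rewrite tT (le_trans s0).
  exact: (H i.+1).
elim: i => [|i IH] {}t st tT ti.
  have -> : t = s by apply/eqP; rewrite eq_le st andbT (le_trans ti)// mul0r.
  by rewrite !subrr enorm0 mulr0.
have [|it] := leP t (i%:R * dt); first exact: IH.
have iT := lt_le_trans it tT.
have [|vL vM] := vLM _ (muP (i%:R * dt) _).
  by rewrite (ltW iT) mulr_ge0// ltW.
have [y ysol Xy] := Xode i x iT.
(* Either [s] and [t] lie in one cell, or the path is cut at the last grid time before [t]. *)
have [si|/ltW si] := leP (i%:R * dt) s.
  rewrite !Xy ?(ltW it)// ?si ?(le_trans st)//.
  exact: solves_speed.
have h1 := IH _ si (ltW iT) (lexx _).
have h2 : enorm (X t x - X (i%:R * dt) x) <= M * (t - i%:R * dt).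
  rewrite !Xy ?lexx ?(ltW it)// ?(ltW iT)//; first exact: solves_speed (ltW it).
  by rewrite ler_wpM2r ?(ltW dt0)// ler_nat.
have := ler_enormB_trans (X (i%:R * dt) x) (X t x) (X s x).
have -> : M * (t - s) = M * (t - i%:R * dt) + M * (i%:R * dt - s) by ring.
lra.
Qed.

End Trajectories.

(** * Comparison of two time steps *)

Section Convergence.
Context {R : realType} {n : nat}.
Implicit Types (v : prob R n -> 'rV[R]_n -> 'rV[R]_n).

Lemma lagrangian_comparison (p : R) v (L M K T h : R) (q N : nat) (m : prob R n)
    (mu nu : R -> prob R n) X Y (t : R) x :
  1 <= p -> 0 < T -> 0 < h -> (0 < q)%N -> T = N%:R * h ->
  field_bounds p v L M K ->
  (forall t : R, 0 <= t <= T -> Pp p (mu t)) ->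
  (forall t : R, 0 <= t <= T -> Pp p (nu t)) ->
  lagrangian v m T (q%:R * h) mu X -> lagrangian v m T h nu Y ->
  0 <= t <= T ->
  enorm (X t x - Y t x) <= (expR ((L + K) * T) - 1) * (2 * M * (q%:R * h)).
Proof.
move=> p1 T0 h0 q0 TE vb muP nuP lX lY.
have [L0 M0 K0 vLM vK] := vb.
have [X0 trX odeX] := lX; have [Y0 trY odeY] := lY.
set a := (L + K) * h; set b := 2 * M * (q%:R * h).
have qh0 : 0 < q%:R * h by rewrite mulr_gt0// ltr0n.
have a0 : 0 <= a by rewrite mulr_ge0 ?addr_ge0// ltW.
have b0 : 0 <= b by rewrite !mulr_ge0// ltW.
(* The exact solution of the recursion [U j.+1 = (1 + a) * U j + a * b] with [U 0 = 0]. *)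
pose U j := ((1 + a) ^+ j - 1) * b.
have U_step j : U j.+1 = (1 + a) * U j + a * b by rewrite /U exprS; ring.
have U_ge0 j : 0 <= U j by rewrite mulr_ge0// subr_ge0 exprn_ege1// lerDl.
have UN : U N <= (expR ((L + K) * T) - 1) * b.
  have -> : (L + K) * T = a * N%:R by rewrite TE /a; ring.
  have hU j : (j < N)%N -> U j.+1 <= (1 + a) * U j + a * b by rewrite U_step.
  have := discrete_gronwall a0 b0 (U_ge0 _) hU.
  by rewrite {2}/U expr0 subrr mul0r add0r; lra.
(* Uniformity in [x] is essential: the fields depend on whole measures, so the step for one
   trajectory uses the bound for all of them. *)
suff H j : forall (t : R) x, 0 <= t <= T -> t <= j%:R * h ->
    enorm (X t x - Y t x) <= U j.
  move=> tT; apply: le_trans UN; apply: H => //.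
  by rewrite -TE; case/andP: tT.
elim: j => [|j IH] {}t {}x tT tj.
  have -> : t = 0.
    by apply/eqP; rewrite eq_le -{1}(mul0r h) tj; case/andP: tT.
  by rewrite X0 Y0 subrr enorm0.
have [tj'|jt] := leP t (j%:R * h).
  apply: le_trans (IH _ _ tT tj') _; rewrite U_step.
  by have := mulr_ge0 a0 (U_ge0 j); have := mulr_ge0 a0 b0; lra.
have tT' : t <= T by case/andP: tT.
have jT : j%:R * h < T := lt_le_trans jt tT'.
have j0 : 0 <= j%:R * h by rewrite mulr_ge0// ltW.
have jT01 : 0 <= j%:R * h <= T by rewrite j0 ltW.
(* The coarse cell that contains the fine cell [j]. *)
pose i := (j %/ q)%N.
have ij : i%:R * (q%:R * h) <= j%:R * h.
  by rewrite mulrA -natrM ler_wpM2r ?(ltW h0)// ler_nat leq_divM.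
have ji : j.+1%:R * h <= i.+1%:R * (q%:R * h).
  by rewrite mulrA -natrM ler_wpM2r ?(ltW h0)// ler_nat ltn_ceil.
have iT01 : 0 <= i%:R * (q%:R * h) <= T.
  by rewrite mulr_ge0 ?(ltW qh0)//= (le_trans ij)// ltW.
have speed z :
    enorm (X (i%:R * (q%:R * h)) z - X (j%:R * h) z) <= M * (q%:R * h).
  rewrite enormBC; apply: (@le_trans _ _ (M * (j%:R * h - i%:R * (q%:R * h)))).
    apply: lagrangian_speed T0 qh0 vb muP lX _ ij _; first by case/andP: iT01.
    exact: ltW.
  rewrite ler_wpM2l// lerBlDr; apply: le_trans (ltW jt) _.
  by apply: le_trans tj _; apply: le_trans ji _; rewrite -[i.+1]addn1 natrD; lra.
(* Compares the two measures at which the fields are frozen, through the intermediate map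
   [X (j%:R * h)]. *)
have Wij : (Wp p (mu (i%:R * (q%:R * h))%R) (nu (j%:R * h)%R) <=
    (M * (q%:R * h) + U j)%:E)%E.
  have [mX muE] := trX _ iT01; have [mY nuE] := trY _ jT01.
  apply: Wp_le_sup p1 mX mY muE nuE _ => z.
  apply: le_trans (ler_enormB_trans (X (j%:R * h) z) _ _) _.
  by rewrite lerD ?speed ?IH.
have [y1 sol1 X1] := odeX i x (le_lt_trans ij jT).
have [y2 sol2 Y2] := odeY j x jT.
have [vL vM] := vLM _ (muP _ iT01); have [_ vM'] := vLM _ (nuP _ jT01).
have := solves_step L0 vL vM vM' (vK _ _ _ (muP _ iT01) (nuP _ jT01) Wij)
  sol1 sol2 (ltW jt).
rewrite -X1 ?(le_trans ij (ltW jt)) ?(le_trans tj ji)//.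
rewrite -X1 ?ij ?(le_trans (ltW jt) (le_trans tj ji)) ?(ltW jT)//.
rewrite -Y2 ?(ltW jt) ?tj// -Y2 ?lexx ?(le_trans (ltW jt) tj) ?(ltW jT)//.
move=> /le_trans; apply.
have th : 0 <= t - j%:R * h <= h.
  by move: tj; rewrite subr_ge0 (ltW jt)/= -addn1 natrD; lra.
rewrite U_step; set s := t - _ in th *; have /andP[s0 sh] := th.
have IHj := IH _ x jT01 (lexx _).
have sB : s <= q%:R * h.
  by apply: le_trans sh _; rewrite ler_peMl ?(ltW h0)// ler1n.
(* The three terms of [solves_step]: with [M * (q%:R * h) <= b] and [2 * M * s <= b], their bounds
   add up to [(1 + a) * U j + a * b]. *)
have E_le : (1 + L * s) * enorm (X (j%:R * h) x - Y (j%:R * h) x) <=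
    (1 + L * h) * U j.
  by rewrite ler_pM ?enorm_ge0 ?addr_ge0 ?mulr_ge0// lerD2l ler_wpM2l.
have K_le : s * (K * (M * (q%:R * h) + U j)) <= h * (K * (b + U j)).
  have Mqh0 := mulr_ge0 M0 (ltW qh0).
  apply: ler_pM => //; first by rewrite mulr_ge0// addr_ge0.
  by rewrite ler_wpM2l// lerD2r /b; move: Mqh0; lra.
have L_le : s * (L * (2 * M * s)) <= h * (L * b).
  by rewrite ler_pM ?mulr_ge0// ler_wpM2l// /b ler_wpM2l// mulr_ge0.
by rewrite /a; move: E_le K_le L_le; lra.
Qed.

End Convergence.

(** * Continuity in time and the Cauchy property *)

Lemma lagrangian_CPp (R : realType) (n : nat) (p L M K T dt : R) v
    (m : prob R n) (mu : R -> prob R n) X :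
  1 <= p -> 0 < T -> 0 < dt -> field_bounds p v L M K ->
  (forall t : R, 0 <= t <= T -> Pp p (mu t)) -> lagrangian v m T dt mu X ->
  CPp p T mu.
Proof.
move=> p1 T0 dt0 vb muP lX; split=> t; rewrite in_itv/= => tT; first exact: muP.
(* The curve is [M]-Lipschitz in time, because characteristics have speed at most [M]. *)
have Wst s : 0 <= s <= T -> (Wp p (mu s) (mu t) <= (M * `|s - t|)%:E)%E.
  move=> sT; have [_ trX _] := lX.
  have [mXs muEs] := trX _ sT; have [mXt muEt] := trX _ tT.
  apply: Wp_le_sup p1 mXs mXt muEs muEt _ => x.
  have speed := lagrangian_speed x T0 dt0 vb muP lX.
  case/andP: sT tT => s0 sT /andP[t0 tT].
  have [st|/ltW ts] := leP s t.
    by rewrite enormBC distrC ger0_norm ?subr_ge0// speed.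
  by rewrite ger0_norm ?subr_ge0// speed.
apply: (@squeeze_cvge _ _ _ _ (cst 0%E) _ (fun s => (M * `|s - t|)%:E)).
- apply: filterS (withinT _ _) => s; rewrite /= in_itv/= => sT.
  by rewrite Wp_ge0 Wst.
- exact: cvg_cst.
apply: cvg_within_filter; rewrite -[0%E]/(0%R%:E).
apply: cvg_EFin; first by near=> s.
have cM : continuous (fun s : R => M * `|s - t|).
  move=> s; apply: (@continuousM R _ (cst M) (fun s => `|s - t|)).
    exact: cst_continuous.
  apply: (@continuous_comp _ _ _ (fun s : R => s - t)).
    by apply: continuousB; [exact: cvg_id|exact: cst_continuous].
  exact: norm_continuous.
have : (fun s : R => M * `|s - t|) @ t --> M * `|t - t| by exact: cM.
by rewrite subrr normr0 mulr0.
Unshelve. all: by end_near. Qed.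

Theorem proposition3 (R : realType) (n : nat) (p T : R)
    (hp : 1 <= p) (hT : 0 < T)
    (v : prob R n -> 'rV[R]_n -> 'rV[R]_n) (hv : hypH p v)
    (mu0 : prob R n) (hmu0 : Pacc mu0)
    (mu : nat -> R -> prob R n)
    (hmu : forall k : nat, scheme1 v mu0 T (T / 2 ^+ k) (mu k)) :
  (forall k : nat, CPp p T (mu k)) /\
  (forall e : R, 0 < e -> exists N : nat, forall k l : nat,
     (N <= k)%N -> (N <= l)%N -> (dCPp p T (mu k) (mu l) < e%:E)%E).
Proof.
have [L [M [K vb]]] := hypH_field_bounds hv.
have [r mu0r] := Pacc_enorm_bounded hmu0.
have p0 : 0 <= p by apply: le_trans hp.
have dt0 k : 0 < T / 2 ^+ k by rewrite divr_gt0// exprn_gt0.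
have lag k := scheme1_lagrangian p0 hT (dt0 k) vb mu0r (hmu k).
have muP k : forall t : R, 0 <= t <= T -> Pp p (mu k t) by have [] := lag k.
have {}lag k : exists X, lagrangian v mu0 T (T / 2 ^+ k) (mu k) X.
  by have [] := lag k.
have {lag}[X lX] := choice lag.
split=> [k|e e0]; first exact: lagrangian_CPp hp hT (dt0 k) vb (muP k) (lX k).
pose C := (expR ((L + K) * T) - 1) * (2 * M).
have comp k l (t : R) x : (k <= l)%N -> 0 <= t <= T ->
    enorm (X k t x - X l t x) <= C * (T / 2 ^+ k).
  move=> kl tT.
  have q0 : (0 < 2 ^ (l - k))%N by rewrite expn_gt0.
  (* Dyadic grids are nested: a step of level [k] consists of [2 ^ (l - k)] steps of level [l]. *)
  have dtE : T / 2 ^+ k = (2 ^ (l - k))%:R * (T / 2 ^+ l).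
    have a0 i : (2 : R) ^+ i != 0 by rewrite expf_neq0.
    rewrite natrX -{2}(subnK kl) exprD.
    by field; rewrite !a0.
  rewrite dtE /C -mulrA; move: (lX k); rewrite dtE => lXk.
  have TE : T = (2 ^ l)%:R * (T / 2 ^+ l).
    by rewrite natrX mulrCA divff ?mulr1// expf_neq0.
  exact: lagrangian_comparison hp hT (dt0 l) q0 TE vb (muP k) (muP l) lXk
    (lX l) tT.
(* For [i >= N] this gives [C * T / e < N <= i < 2 ^ i]. *)
pose N := (Num.truncn (C * T / e)).+1.
have CN i : (N <= i)%N -> C * (T / 2 ^+ i) < e.
  move=> Ni; rewrite mulrA ltr_pdivrMr ?exprn_gt0// (mulrC e) -ltr_pdivrMr//.
  apply: lt_le_trans (truncnS_gt _) _; rewrite -natrX ler_nat.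
  by apply: leq_trans Ni _; exact/ltnW/ltn_expl.
exists N => k l Nk Nl.
have CNm : C * (T / 2 ^+ (minn k l)) < e by rewrite CN// leq_min Nk.
(* A supremum of values below [e] could equal [e]; the bound at the coarser level [minn k l] is
   uniform in time and strictly below [e]. *)
apply: le_lt_trans (_ : (_ <= (C * (T / 2 ^+ (minn k l)))%:E)%E) _; last first.
  by rewrite lte_fin.
apply: ge_ereal_sup => _ [t tT <-]; rewrite /= in_itv/= in tT.
have [_ trk _] := lX k; have [_ trl _] := lX l.
have [mXk muEk] := trk _ tT; have [mXl muEl] := trl _ tT.
apply: Wp_le_sup hp mXk mXl muEk muEl _ => x.
have [kl|/ltnW lk] := leqP k l; first exact: comp.
by rewrite enormBC; exact: comp.
Qed.
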